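(* Let $V$ be a finite dimensional real vector space with a non-degenerate symmetric bilinear form $(\cdot,\cdot)$ of signature $(p,q)$, let $J$ be a pseudo-Hermitian almost complex structure on $V$, and let $R\in\otimes^4V^*$ be an algebraic curvature tensor on $V$. Then $R$ is almost complex if and only if $J^*R=R$, i.e. if and only if $R(x,y,z,w)=R(Jx,Jy,Jz,Jw)$ for all $x,y,z,w\in V$.
   Context: A 4-tensor $R$ (a multilinear map $R:V^4\to\mathbb{R}$) is an algebraic curvature tensor if for all $x,y,z,w\in V$: $R(x,y,z,w)=-R(y,x,z,w)$; $R(x,y,z,w)=R(z,w,x,y)$; and $R(x,y,z,w)+R(y,z,x,w)+R(z,x,y,w)=0$. The associated curvature operator $R(x,y):V\to V$ is the linear map defined by $(R(x,y)z,w)=R(x,y,z,w)$. A 2-plane $\pi\subset V$ is non-degenerate if the restriction of $(\cdot,\cdot)$ to $\pi$ is non-degenerate. If $\{x,y\}$ is an oriented basis of a non-degenerate oriented 2-plane $\pi$, the skew-symmetric curvature operator is $R(\pi):=|(x,x)(y,y)-(x,y)^2|^{-1/2}R(x,y)$. A pseudo-Hermitian almost complex structure $J$ on $V$ is a linear isometry of $(V,(\cdot,\cdot))$ with $J^2=-\mathrm{Id}$. A 2-plane $\pi$ is a complex line if $J\pi=\pi$; complex lines are oriented by bases of the form $\{x,Jx\}$. The algebraic curvature tensor $R$ is almost complex if $JR(\pi)=R(\pi)J$ for every non-degenerate complex line $\pi$. *)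

(* Defs.v *)
From HB Require Import structures.
From mathcomp Require Export all_boot all_order all_algebra.
From mathcomp Require Export boolp classical_sets reals.
From mathcomp Require Import ring.

Set Implicit Arguments.
Unset Strict Implicit.
Unset Printing Implicit Defensive.

Import Order.TTheory GRing.Theory Num.Theory.
Local Open Scope ring_scope.

Section Definitions.
Variables (R : realType) (V : vectType R).
Implicit Types (g : {symmetric V}) (J : 'End(V)) (pi : {vspace V}).
Implicit Types (T : V -> V -> V -> V -> R).

(* Convention: [p] is the number of negative squares, [q] of positive ones. *)
Definition has_signature g (p q : nat) : Prop :=
  exists2 e : (p + q).-tuple V, basis_of fullv e &
    forall i j : 'I_(p + q),
      g e`_i e`_j = if i == j then (if (i < p)%N then -1 else 1) else 0.

Definition multilinear4 T : Prop :=
  [/\ forall y z w, scalar (fun x => T x y z w),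
      forall x z w, scalar (fun y => T x y z w),
      forall x y w, scalar (fun z => T x y z w)
    & forall x y z, scalar (fun w => T x y z w)].

Record algebraic_curvature_tensor T : Prop := AlgebraicCurvatureTensor {
  act_multilinear : multilinear4 T;
  act_skew : forall x y z w, T x y z w = - T y x z w;
  act_pair : forall x y z w, T x y z w = T z w x y;
  act_bianchi : forall x y z w, T x y z w + T y z x w + T z x y w = 0 }.

(* The linear map R(x,y) determined by (R(x,y)z,w) = R(x,y,z,w); existence and
   uniqueness, for nondegenerate [g], are [curvature_opP] and
   [curvature_op_unique] below. *)
Definition curvature_op g T (x y : V) : 'End(V) :=
  xget 0 [set A : 'End(V) | forall z w, g (A z) w = T x y z w].

Definition nondegenerate_on g pi : Prop :=
  {in pi, forall x, {in pi, forall y, g x y = 0} -> x = 0}.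

(* An oriented 2-plane is given by an oriented basis [x, y]; on nondegenerate
   planes the result only depends on the plane and its orientation, see
   [skew_curvature_op_oriented]. *)
Definition skew_curvature_op g T (x y : V) : 'End(V) :=
  (Num.sqrt `|g x x * g y y - g x y ^+ 2|)^-1 *: curvature_op g T x y.

Definition pseudo_hermitian_acs g J : Prop :=
  isometry g g J /\ (J \o J)%VF = - \1%VF.

Definition complex_line J pi : Prop := \dim pi = 2%N /\ (J @: pi)%VS = pi.

(* [x] ranges over all vectors giving an oriented basis [x, J x] of [pi]; there
   is always at least one, see [complex_line_basis]. *)
Definition almost_complex g J T : Prop :=
  forall pi, complex_line J pi -> nondegenerate_on g pi ->
  forall x, basis_of pi [:: x; J x] ->
    (J \o skew_curvature_op g T x (J x))%VF
    = (skew_curvature_op g T x (J x) \o J)%VF.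

End Definitions.

Section Facts.
Variables (R : realType) (V : vectType R).
Implicit Types (g : {symmetric V}) (J : 'End(V)) (pi : {vspace V}).
Implicit Types (T : V -> V -> V -> V -> R).

Lemma form_sym g x y : g x y = g y x.
Proof. by rewrite hermC expr0 mul1r. Qed.

Lemma nondegenerate_inj g x y :
  nondegenerate g -> (forall w, g x w = g y w) -> x = y.
Proof.
move=> /eqP ndg h; apply/eqP; rewrite -subr_eq0 -memv0 -ndg.
by apply/mem_orthovP => w _; rewrite linearBl /= h subrr.
Qed.

Lemma curvature_op_unique g T x y (A B : 'End(V)) : nondegenerate g ->
  (forall z w, g (A z) w = T x y z w) -> (forall z w, g (B z) w = T x y z w) ->
  A = B.
Proof.
by move=> ndg hA hB; apply/lfunP => z; apply: (nondegenerate_inj ndg) => w;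
  rewrite hA hB.
Qed.

Lemma curvature_opP g T x y z w : nondegenerate g -> multilinear4 T ->
  g (curvature_op g T x y z) w = T x y z w.
Proof.
move=> ndg [_ _ l3 l4].
suff [A hA] : exists A : 'End(V), forall z w, g (A z) w = T x y z w.
  by rewrite /curvature_op; case: xgetP => [B _ ->|/(_ A)].
have linfunE (aT rT : vectType R) (f : aT -> rT) : linear f -> linfun f =1 f.
  by move=> lf v; rewrite (lfunE (HB.pack f (GRing.isLinear.Build _ _ _ _ f lf))).
pose dl (v : V) := linfun (g v : V -> R^o).
have dlE v u : dl v u = g v u by rewrite linfunE // => a s t; exact: linearPr.
have dl_lin : linear dl.
  move=> a u v; apply/lfunP => t.
  by rewrite add_lfunE scale_lfunE !dlE; exact: linearPl.
pose F := linfun dl.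
have FE v u : F v u = g v u by rewrite /F linfunE // dlE.
have F0 : lker F == 0%VS.
  apply/lker0P => u v E; apply: (nondegenerate_inj ndg) => t.
  by rewrite -!FE E.
have Ffull : limg F = fullv.
  apply/eqP; rewrite eqEdim subvf /= limg_dim_eq ?(eqP F0) ?capv0 //.
  by rewrite !dimvf /dim /= muln1.
pose tl (u : V) := linfun (T x y u : V -> R^o).
have tlE u v : tl u v = T x y u v by rewrite linfunE //; exact: l4.
have tl_lin : linear tl.
  move=> a u v; apply/lfunP => t.
  by rewrite add_lfunE scale_lfunE !tlE; exact: l3.
exists (F^-1 \o linfun tl)%VF => u v.
rewrite comp_lfunE -FE limg_lfunVK; last by rewrite Ffull memvf.
by rewrite linfunE // tlE.
Qed.

Lemma skew_curvature_op_oriented g T x y (a b c d : R) : nondegenerate g ->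
  algebraic_curvature_tensor T -> 0 < a * d - b * c ->
  skew_curvature_op g T (a *: x + b *: y) (c *: x + d *: y)
  = skew_curvature_op g T x y.
Proof.
move=> ndg hT D0; have ml := act_multilinear hT; have [l1 l2 _ _] := ml.
have sk0 u z w : T u u z w = 0.
  by apply/eqP; rewrite -[_ == 0](mulrn_eq0 _ 2) mulr2n {1}(act_skew hT) addNr.
set u := a *: x + b *: y; set v := c *: x + d *: y.
have E : curvature_op g T u v = (a * d - b * c) *: curvature_op g T x y.
  apply: (@curvature_op_unique g T u v) => // z w; first exact: curvature_opP.
  rewrite scale_lfunE linearZl_LR /= curvature_opP // /u /v.
  have Z1 k s t : T (k *: s) t z w = k * T s t z w.
    have T0 : T 0 t z w = 0.
      have /= := l1 t z w (-1) 0 0.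
      by rewrite scaleN1r oppr0 addr0 mulN1r addNr.
    by have /= := l1 t z w k s 0; rewrite T0 !addr0.
  have Z2 k s t : T t (k *: s) z w = k * T t s z w.
    by rewrite (act_skew hT) Z1 (act_skew hT s) mulrN opprK.
  rewrite l1 Z1 !l2 !Z2 !sk0 (act_skew hT y x).
  by ring.
rewrite /skew_curvature_op E scalerA; congr (_ *: _).
have -> : g u u * g v v - g u v ^+ 2
  = (a * d - b * c) ^+ 2 * (g x x * g y y - g x y ^+ 2).
  rewrite /u /v !(linearDl, linearDr) !linearZl_LR /= !linearZr_LR /=.
  by rewrite (form_sym g y x); ring.
rewrite normrM (ger0_norm (sqr_ge0 _)) sqrtrM ?sqr_ge0 // sqrtr_sqr (gtr0_norm D0).
by rewrite invfM mulrAC mulVf ?mul1r // gt_eqF.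
Qed.

Lemma complex_line_basis g J pi :
  pseudo_hermitian_acs g J -> complex_line J pi ->
  exists x, basis_of pi [:: x; J x].
Proof.
move=> [_ JJ] [dpi Jpi].
have JJE v : J (J v) = - v.
  by have := congr1 (fun f : 'End(V) => f v) JJ; rewrite comp_lfunE opp_lfunE id_lfunE.
have pi0 : pi != 0%VS by rewrite -dimv_eq0 dpi.
exists (vpick pi); set x := vpick pi.
have xpi : x \in pi := memv_pick pi.
have x0 : x != 0 by rewrite vpick0.
rewrite basisEdim dpi leqnn andbT.
have Jxpi : J x \in pi by rewrite -Jpi memv_img.
suff fr : free [:: x; J x].
  have /eqP s : (<<[:: x; J x]>> == pi)%VS.
    rewrite eqEdim dpi (eqP fr) leqnn andbT.
    by apply/span_subvP => t; rewrite !inE => /orP[] /eqP ->.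
  by rewrite s subvv.
rewrite free_cons span_seq1 seq1_free; apply/andP; split; last first.
  by apply: contraNneq x0 => Jx0; rewrite -oppr_eq0 -JJE Jx0 linear0.
apply/negP => /vlineP[k xE].
have : x = - (k ^+ 2) *: x.
  rewrite {1}xE {1}xE linearZ /= JJE scalerA scalerN scaleNr expr2 //.
move/eqP; rewrite scaleNr -addr_eq0 -[X in X + _]scale1r -scalerDl scaler_eq0.
by rewrite (negPf x0) orbF gt_eqF // ltr_wpDr ?sqr_ge0.
Qed.

End Facts.

(* Main.v *)
(** Invariance of [T x (J x) z w] under replacing [z, w] by [J z, J w] is what
    almost complexity says at a non-null [x]; it extends to null [x] because, by
    the parallelogram identity, a quadratic function vanishing at the non-null
    vectors [x0], [x + x0] and [x - x0] vanishes at [x].  Polarizing it gives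
    [T(x,y,z,w) + T(Jx,Jy,z,w) = T(x,y,Jz,Jw) + T(Jx,Jy,Jz,Jw)]; adding the same
    identity with the pairs [(x,y)] and [(z,w)] exchanged gives [T = J^* T]. *)
Require Import Defs.
From mathcomp Require Import all_boot all_order all_algebra reals.
From mathcomp Require Import ring lra.

Set Implicit Arguments.
Unset Strict Implicit.
Unset Printing Implicit Defensive.

Import Order.TTheory GRing.Theory Num.Theory.

Local Open Scope ring_scope.

Section CurvatureTensor.
Variables (R : realType) (V : vectType R) (T : V -> V -> V -> V -> R).
Hypothesis T_act : algebraic_curvature_tensor T.

Lemma act_addl x y z w t : T (x + t) y z w = T x y z w + T t y z w.
Proof.
have [l _ _ _] := act_multilinear T_act.
by have /= := l y z w 1 x t; rewrite scale1r mul1r.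
Qed.

Lemma act_oppl x y z w : T (- x) y z w = - T x y z w.
Proof.
have [l _ _ _] := act_multilinear T_act.
have /= := l y z w (-1) x x; rewrite scaleN1r addNr => T0.
have /= := l y z w (-1) x 0; rewrite scaleN1r addr0 T0; lra.
Qed.

Lemma act_addr x y z w t : T x (y + t) z w = T x y z w + T x t z w.
Proof. by rewrite !(act_skew T_act x) act_addl opprD. Qed.

Lemma act_oppr x y z w : T x (- y) z w = - T x y z w.
Proof. by rewrite !(act_skew T_act x) act_oppl. Qed.

End CurvatureTensor.

Section PseudoHermitian.
Variables (R : realType) (V : vectType R) (g : {symmetric V}) (J : 'End(V)).
Hypotheses (g_nondeg : nondegenerate g) (J_acs : pseudo_hermitian_acs g J).

Lemma acsK v : J (J v) = - v.
Proof.
have [_ JJ] := J_acs.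
by have := congr1 (fun f : 'End(V) => f v) JJ; rewrite comp_lfunE opp_lfunE id_lfunE.
Qed.

Lemma acs_form u v : g (J u) (J v) = g u v.
Proof. by have [gJ _] := J_acs; apply: gJ. Qed.

Lemma acs_form_skew u v : g (J u) v = - g u (J v).
Proof. by rewrite -acs_form acsK linearNl. Qed.

Lemma acs_orth x : g x (J x) = 0.
Proof. have := acs_form_skew x x; rewrite form_sym; lra. Qed.

Lemma free_acs x : g x x != 0 -> free [:: x; J x].
Proof.
move=> gx; rewrite free_cons span_seq1 seq1_free; apply/andP; split.
  apply: contraNN gx => /vlineP[k xE].
  by rewrite {2}xE linearZr_LR /= acs_orth mulr0.
by apply: contraNneq gx => Jx0; rewrite -acs_form Jx0 linear0l.
Qed.

Lemma complex_line_span x : g x x != 0 -> complex_line J <<[:: x; J x]>>.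
Proof.
move=> gx; have /eqP dimE := free_acs gx; split=> //.
rewrite limg_span /= acsK; apply/eqP; rewrite eqEsubv.
apply/andP; split; apply/span_subvP => t; rewrite !inE => /orP[] /eqP ->.
- by rewrite memv_span // !inE eqxx orbT.
- by rewrite memvN memv_span // inE eqxx.
- by rewrite -memvN memv_span // !inE eqxx orbT.
- by rewrite memv_span // inE eqxx.
Qed.

(** In the basis [x], [J x] the form is [g x x] times the identity matrix, so pairing [v] with both
    generators recovers its coordinates up to the nonzero factor [g x x]. *)
Lemma nondegenerate_span_acs x : g x x != 0 ->
  nondegenerate_on g <<[:: x; J x]>>.
Proof.
move=> gx v + orth; have /= gvx := orth x; have /= gvJx := orth (J x).
rewrite span_cons span_seq1 => /memv_addP[_ /vlineP[a ->] [_ /vlineP[b ->] vE]].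
move: gvx gvJx; rewrite !memv_span ?inE ?eqxx ?orbT // => /(_ isT) + /(_ isT).
rewrite vE !linearDl /= !linearZl_LR /= acs_form acs_orth (form_sym g (J x)).
rewrite acs_orth !mulr0 addr0 add0r => /eqP + /eqP.
by rewrite !mulf_eq0 (negPf gx) !orbF => /eqP -> /eqP ->; rewrite !scale0r addr0.
Qed.

(** With [A] the curvature operator, compare [g (J (A z)) (J w) = g (A z) w] and
    [g (A (J z)) (J w)]; nondegeneracy gives the way back. *)
Lemma curvature_op_commP T x y : multilinear4 T ->
  (J \o curvature_op g T x y = curvature_op g T x y \o J)%VF <->
  forall z w, T x y (J z) (J w) = T x y z w.
Proof.
move=> ml; split=> [JA z w|TJ].
  rewrite -!(curvature_opP _ _ _ _ g_nondeg ml) -[RHS]acs_form.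
  by congr (g _ _); rewrite -!comp_lfunE JA.
apply/lfunP => z; apply: (nondegenerate_inj g_nondeg) => w.
(* Writing [w] as [J (J (- w))] lets the isometry property strip the [J] in front of the
   operator. *)
rewrite !comp_lfunE -[w]opprK -acsK acs_form.
by rewrite !curvature_opP // TJ.
Qed.

(** If every vector is null, polarization makes [g] vanish identically, and nondegeneracy leaves
    only the zero space. *)
Lemma form_nonnull_or_trivial : (exists x, g x x != 0) \/ (forall x : V, x = 0).
Proof.
have [|null] := pselect (exists x, g x x != 0); [by left | right => x].
have g0 y : g y y = 0 by apply: contra_notP null => /eqP; exists y.
apply: (nondegenerate_inj g_nondeg) => w; rewrite linear0l.
have := g0 (x + w); rewrite linearDl !linearDr /= !g0 (form_sym g w); lra.
Qed.

Lemma null_shift x x0 : g x x = 0 -> g x0 x0 != 0 ->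
  exists y, [/\ g y y != 0, g (x + y) (x + y) != 0 & g (x - y) (x - y) != 0].
Proof.
(* For null [x], the square of [x ± t *: x0] is [t * (t ± 2 * c) * g x0 x0]; any [t] above [2 * |c|]
   keeps both nonzero. *)
move=> gx gx0; pose c := g x x0 / g x0 x0; pose t := 2 * `|c| + 1.
have t0 : t != 0 by apply: lt0r_neq0; rewrite ltr_wpDl // mulr_ge0.
have [tc1 tc2] : t + 2 * c != 0 /\ t - 2 * c != 0.
  have := ler_norm c; have := ler_norm (- c); rewrite normrN /t => h1 h2.
  by split; apply: lt0r_neq0; lra.
have cE : g x x0 = c * g x0 x0 by rewrite /c divfK.
exists (t *: x0); split.
- by rewrite linearZl_LR linearZr_LR /= !mulf_neq0.
- suff -> : g (x + t *: x0) (x + t *: x0) = t * (t + 2 * c) * g x0 x0.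
    by rewrite !mulf_neq0.
  rewrite linearDl !linearDr /= !linearZl_LR /= !linearZr_LR /= gx (form_sym g x0) cE.
  by ring.
- suff -> : g (x - t *: x0) (x - t *: x0) = t * (t - 2 * c) * g x0 x0.
    by rewrite !mulf_neq0.
  rewrite -scaleNr linearDl !linearDr /= !linearZl_LR /= !linearZr_LR /= gx.
  rewrite (form_sym g x0) cE.
  by ring.
Qed.

End PseudoHermitian.

Theorem theorem1 (R : realType) (V : vectType R) (g : {symmetric V})
    (p q : nat) (J : 'End(V)) (T : V -> V -> V -> V -> R)
    (g_nondeg : nondegenerate g) (g_sig : has_signature g p q)
    (J_acs : pseudo_hermitian_acs g J) (T_act : algebraic_curvature_tensor T) :
  almost_complex g J T <->
  (forall x y z w : V, T x y z w = T (J x) (J y) (J z) (J w)).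
Proof.
have ml := act_multilinear T_act.
have JK := acsK J_acs.
split=> [ac | TJ pi _ _ x _]; last first.
  rewrite /skew_curvature_op -comp_lfunZl -comp_lfunZr; congr (_ *: _).
  apply/(curvature_op_commP g_nondeg J_acs _ _ ml) => z w.
  (* Invariance turns the pair [(x, J x)] into [(J x, - x)], which skew-symmetry brings back to
     [(x, J x)]. *)
  by rewrite [RHS]TJ JK act_oppr // -act_skew.
have nonnull x : g x x != 0 ->
    forall z w, T x (J x) (J z) (J w) = T x (J x) z w.
  move=> gx; apply/(curvature_op_commP g_nondeg J_acs _ _ ml).
  have := ac _ (complex_line_span J_acs gx) (nondegenerate_span_acs J_acs gx) x.
  rewrite /basis_of eqxx (free_acs J_acs gx) => /(_ isT).
  (* The normalizing factor cancels: the Gram determinant of [x], [J x] is the square of [g x x],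
     hence nonzero. *)
  rewrite /skew_curvature_op -comp_lfunZl -comp_lfunZr; apply: scalerI.
  rewrite invr_eq0 sqrtr_eq0 -ltNge normr_gt0 (acs_form J_acs) (acs_orth J_acs).
  by rewrite expr0n subr0 mulf_neq0.
have quad x z w : T x (J x) (J z) (J w) = T x (J x) z w.
  have [[x0 gx0]|triv] := form_nonnull_or_trivial g_nondeg; last first.
    by rewrite [J z]triv [J w]triv [z]triv [w]triv.
  have [gx|/nonnull //] := eqVneq (g x x) 0.
  have [y [gy gp gm]] := null_shift gx gx0.
  (* Parallelogram identity for the difference of the two sides, as a quadratic function of [x]. *)
  move: (nonnull _ gy z w) (nonnull _ gp z w) (nonnull _ gm z w).
  rewrite !(linearD, linearN) /=.
  rewrite !(act_addl T_act, act_addr T_act, act_oppl T_act, act_oppr T_act).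
  lra.
have polar x y z w : T x y z w + T (J x) (J y) z w
    = T x y (J z) (J w) + T (J x) (J y) (J z) (J w).
  (* Polarizing at [x + J y] rather than [x + y]: since [J (J y) = - y], the cross terms are [T x y]
     and [T (J x) (J y)], with the same sign. *)
  move: (quad (x + J y) z w) (quad x z w) (quad (J y) z w).
  rewrite !linearD /= !JK.
  rewrite !(act_addl T_act, act_addr T_act, act_oppr T_act) !(act_skew T_act (J y)).
  lra.
(* Pair symmetry puts the exchanged identity in the same terms; on adding, those with [J] on only
   one pair cancel. *)
move=> x y z w; have := polar z w x y.
rewrite !(act_pair T_act z) !(act_pair T_act (J z)).
have := polar x y z w; lra.
Qed.
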